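(* Let $A$ be a proper unital $*$-ring such that $A_\Sigma\cap-A_\Sigma=\{0\}$ and $A_+A_+\cap A_{\mathrm{sa}}=A_+$. Then for every $a\in A_+$ we have $a\in\{a^2\}''$, i.e. $a$ commutes with every element of $A$ that commutes with $a^2$.
   Context: A $*$-ring is an associative ring with a map $a\mapsto a^*$ satisfying $a^{**}=a$, $(ab)^*=b^*a^*$, $(a+b)^*=a^*+b^*$; it is proper if $a^*a=0$ implies $a=0$. Unital means having a two-sided unit $1$. $A_{\mathrm{sa}}=\{a\in A:a=a^*\}$. $A_\Sigma$ is the set of all finite sums $\sum_{k=1}^n a_k^*a_k$ with $n\geq1$, $a_k\in A$. $A_+=\{a\in A:na\in A_\Sigma\text{ for some positive integer }n\}$. $A_+A_+=\{ab:a,b\in A_+\}$. For $B\subseteq A$, $B'=\{a\in A:\forall b\in B\ (ab=ba)\}$ and $B''=(B')'$. *)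

(* Defs.v *)
From HB Require Import structures.
From mathcomp Require Import all_boot all_algebra.
From mathcomp Require Import classical_sets.

Set Implicit Arguments.
Unset Strict Implicit.
Unset Printing Implicit Defensive.

Import GRing.Theory.
Local Open Scope classical_set_scope.
Local Open Scope ring_scope.

(* Unital *-rings; the base structure pzRingType includes the zero ring. *)
HB.mixin Record PzRing_isStarRing A of GRing.PzRing A := {
  star : A -> A;
  starK : forall a, star (star a) = a;
  starM : forall a b, star (a * b) = star b * star a;
  starD : forall a b, star (a + b) = star a + star b
}.

#[short(type="starRingType")]
HB.structure Definition StarRing :=
  { A of GRing.PzRing A & PzRing_isStarRing A }.

Definition proper_star (A : starRingType) : Prop :=
  forall a : A, star a * a = 0 -> a = 0.

Definition self_adjoint (A : starRingType) : set A := [set a | a = star a].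
Arguments self_adjoint : clear implicits.

Definition star_sums (A : starRingType) : set A :=
  [set x | exists (n : nat) (a : 'I_n -> A),
     (1 <= n)%N /\ x = \sum_(k < n) star (a k) * a k].
Arguments star_sums : clear implicits.

Definition positives (A : starRingType) : set A :=
  [set a | exists n : nat, (0 < n)%N /\ star_sums A (a *+ n)].
Arguments positives : clear implicits.

Definition commutant (A : starRingType) (B : set A) : set A :=
  [set a | forall b, B b -> a * b = b * a].

(* Main.v *)
Require Import Defs.
From HB Require Import structures.
From mathcomp Require Import all_boot all_algebra.
From mathcomp Require Import classical_sets.

Set Implicit Arguments.
Unset Strict Implicit.
Unset Printing Implicit Defensive.

Import GRing.Theory.
Local Open Scope classical_set_scope.
Local Open Scope ring_scope.

(** Let [a] be positive and let [b] commute with [a ^+ 2]. The commutator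
    [d = a * b - b * a] anticommutes with [a], hence so does [star d], and
    therefore [star d * d] commutes with [a]. The product [a * (star d * d)] of
    two positive elements is thus self-adjoint, so it is positive. But it also
    equals [- (star d * a * d)], the opposite of a positive element. Since the
    cone of positives is salient ([positives_antisym]), [star d * a * d = 0],
    which forces [a * d = 0] because a vanishing sum of terms [star x * x] has
    all its terms zero ([positives_conj_eq0]); by anticommutation [d * a = 0]
    as well. Expanding one factor of [star d * d] gives
    [star d * d = - (a * star b * d)], so [d * (star d * d) = 0], and properness
    used twice yields [d = 0].

    Elements are positive only up to an integer multiple, so the two vanishing
    statements also need [A] to be torsion-free. This is [mulrn_eq0_proper]:
    if [x *+ n = 0] then [star x * x] is the opposite of [n - 1] copies of
    itself. *)

Section StarTheory.
Variable A : starRingType.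
Implicit Types a b c d x : A.

Lemma star0 : star (0 : A) = 0.
Proof. by apply: (addrI (star 0)); rewrite -starD !addr0. Qed.

Lemma starN a : star (- a) = - star a.
Proof. by apply/eqP; rewrite -addr_eq0 -starD addNr star0. Qed.

Lemma starB a b : star (a - b) = star a - star b.
Proof. by rewrite starD starN. Qed.

Lemma star_sums_square x : star_sums A (star x * x).
Proof. by exists 1%N, (fun=> x); rewrite big_ord1. Qed.

Lemma star_sumsD x y : star_sums A x -> star_sums A y -> star_sums A (x + y).
Proof.
move=> [m [a [m_gt0 ->]]] [n [b [n_gt0 ->]]].
exists (m + n)%N, (fun k => match split k with inl i => a i | inr j => b j end).
split; first by rewrite addn_gt0 m_gt0.
rewrite big_split_ord; congr (_ + _); apply: eq_bigr => i _.
  by rewrite -[lshift n i]/(unsplit (inl i)) unsplitK.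
by rewrite -[rshift m i]/(unsplit (inr i)) unsplitK.
Qed.

Lemma star_sumsMn x n : (0 < n)%N -> star_sums A x -> star_sums A (x *+ n).
Proof.
case: n => // n _ sx; elim: n => [|n IHn]; first by rewrite mulr1n.
by rewrite mulrS; apply: star_sumsD.
Qed.

Lemma star_sums_conj d x : star_sums A x -> star_sums A (star d * x * d).
Proof.
move=> [n [a [n_gt0 ->]]]; exists n, (fun k => a k * d); split=> //.
rewrite mulr_sumr mulr_suml; apply: eq_bigr => k _.
by rewrite starM !mulrA.
Qed.

Lemma positives_square x : positives A (star x * x).
Proof. by exists 1%N; split=> //; apply: star_sums_square. Qed.

Lemma positives_conj d a : positives A a -> positives A (star d * a * d).
Proof.
move=> [n [n_gt0 sa]]; exists n; split=> //.
by rewrite -mulrnAl -mulrnAr; apply: star_sums_conj.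
Qed.

Hypothesis A_proper : proper_star A.
Hypothesis A_sums : star_sums A `&` [set - x | x in star_sums A] = [set 0].

Lemma star_sums_antisym x : star_sums A x -> star_sums A (- x) -> x = 0.
Proof.
move=> sx sNx; suff: [set 0] x by [].
by rewrite -A_sums; split=> //; exists (- x); rewrite ?opprK.
Qed.

Lemma mulrn_eq0_proper x n : (0 < n)%N -> x *+ n = 0 -> x = 0.
Proof.
case: n => [|[|n]] // _ xn0.
apply: A_proper; apply: star_sums_antisym; first exact: star_sums_square.
suff -> : - (star x * x) = (star x * x) *+ n.+1.
  by apply: star_sumsMn => //; apply: star_sums_square.
by apply/eqP; rewrite eq_sym -addr_eq0 addrC -mulrS -mulrnAr xn0 mulr0.
Qed.

(** The remaining terms of the sum are the opposite of the chosen one, and they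
    again form a sum of hermitian squares. *)
Lemma sum_star_eq0 n (a : 'I_n -> A) :
  \sum_(k < n) star (a k) * a k = 0 -> forall k, a k = 0.
Proof.
move=> sum0 k; apply: A_proper.
apply: star_sums_antisym; first exact: star_sums_square.
have -> : - (star (a k) * a k) = \sum_(i < n | i != k) star (a i) * a i.
  apply/eqP; rewrite eq_sym -addr_eq0 addrC.
  by move: sum0; rewrite (bigD1 k) //= => ->.
(* Zeroing the k-th entry, instead of deleting it, keeps the index type
   nonempty even when n = 1. *)
exists n, (fun i => if i != k then a i else 0).
split; first exact: leq_ltn_trans (ltn_ord k).
by rewrite big_mkcond; apply: eq_bigr => i _; case: ifP; rewrite ?mulr0.
Qed.

Lemma positives_antisym a : positives A a -> positives A (- a) -> a = 0.
Proof.
move=> [m [m_gt0 sa]] [n [n_gt0 sNa]].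
apply: (@mulrn_eq0_proper _ (m * n)%N); first by rewrite muln_gt0 m_gt0.
apply: star_sums_antisym; first by rewrite mulrnA; apply: star_sumsMn.
by rewrite -mulNrn mulnC mulrnA; apply: star_sumsMn.
Qed.

(** If [a *+ n] is the sum of the [star (c k) * c k], then the hypothesis says
    that the squares of the [c k * d] sum to zero, so every [c k * d] vanishes. *)
Lemma positives_conj_eq0 a d :
  positives A a -> star d * a * d = 0 -> a * d = 0.
Proof.
move=> [n [n_gt0 [m [c [_ anE]]]]] dad0.
apply: (mulrn_eq0_proper n_gt0); rewrite -mulrnAl anE mulr_suml.
have cd0 : forall k, c k * d = 0.
  apply: sum_star_eq0; transitivity (star d * (a *+ n) * d).
    rewrite anE mulr_sumr mulr_suml; apply: eq_bigr => k _.
    by rewrite starM !mulrA.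
  by rewrite mulrnAr mulrnAl dad0 mul0rn.
by apply: big1 => k _; rewrite -mulrA cd0 mulr0.
Qed.

End StarTheory.

Theorem theorem2 (A : starRingType)
  (A_proper : proper_star A)
  (A_sums : star_sums A `&` [set - x | x in star_sums A] = [set 0])
  (A_prod : [set a * b | a in positives A & b in positives A]
              `&` self_adjoint A = positives A) :
  forall a : A, positives A a -> commutant (commutant [set a ^+ 2]) a.
Proof.
move=> a pa b ba2.
have {}ba2 : b * a * a = a * a * b.
  by have := ba2 _ (erefl (a ^+ 2)); rewrite expr2 mulrA.
have sa : star a = a by move: (pa); rewrite -A_prod => -[_ /esym].
apply/eqP; rewrite -subr_eq0; apply/eqP; set d := a * b - b * a.
have adN : a * d = - (d * a).
  by rewrite /d mulrBr mulrBl opprB !mulrA ba2.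
have dsaN : star d * a = - (a * star d).
  by have := congr1 (@star A) adN; rewrite starN !starM sa.
have addE : a * (star d * d) = - (star d * a * d).
  by rewrite dsaN mulNr opprK mulrA.
have add_sa : self_adjoint A (a * (star d * d)).
  by rewrite /self_adjoint /= addE starN !starM starK sa mulrA.
have padd : positives A (a * (star d * d)).
  rewrite -A_prod; split=> //.
  by exists a => //; exists (star d * d) => //; apply: positives_square.
have ad0 : a * d = 0.
  apply: (positives_conj_eq0 A_proper A_sums pa).
  apply: (positives_antisym A_proper A_sums); first exact: positives_conj.
  by rewrite -addE.
have da0 : d * a = 0 by apply/eqP; rewrite -oppr_eq0 -adN ad0.
have ddE : star d * d = - (a * star b * d).
  rewrite {1}/d starB !starM sa mulrBl -[star b * a * d]mulrA ad0 mulr0.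
  by rewrite sub0r.
have ddd0 : d * (star d * d) = 0 by rewrite ddE mulrN !mulrA da0 !mul0r oppr0.
do 2!apply: (A_proper).
by rewrite starM starK -mulrA ddd0 mulr0.
Qed.
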